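(* Let $M$ be a finite-dimensional smooth manifold and let $g,\overline{g}$ be two Riemannian metrics on $M$, with Levi-Civita connections $\nabla$ and $\overline{\nabla}$ respectively, which are in a $g$-subgeodesic correspondence; that is, there exist a $1$-form $\theta\in\Omega^1(M)$ and a vector field $P\in\mathcal{X}(M)$ such that $A:=\overline{\nabla}-\nabla$ satisfies $$A(X,Y)=\theta(X)Y+\theta(Y)X+g(X,Y)P\qquad\text{for all }X,Y\in\mathcal{X}(M).$$ Let $\psi\in\Omega^1(M)$ be the $g$-dual of $P$, i.e. $\psi(X)=g(P,X)$ for all $X\in\mathcal{X}(M)$. Then $(M,g,A)$ is a formal Frobenius structure if and only if for every $X,Y,Z\in\mathcal{X}(M)$ $$\theta(X)g(Y,Z)+\psi(Z)g(Y,X)=\theta(Z)g(Y,X)+\psi(X)g(Y,Z).$$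
   Context: $\mathcal{X}(M)$ denotes the smooth vector fields on $M$ and $\Omega^1(M)$ the smooth $1$-forms. For a Riemannian metric $g$ on $M$ and a tensor field $A$ of type $(1,2)$ (a $C^\infty(M)$-bilinear map $\mathcal{X}(M)\times\mathcal{X}(M)\to\mathcal{X}(M)$), the triple $(M,g,A)$ is called a formal Frobenius structure if (i) $g(A(X,Y),Z)=g(X,A(Y,Z))$ for all $X,Y,Z\in\mathcal{X}(M)$, and (ii) $A(X,Y)=A(Y,X)$ for all $X,Y\in\mathcal{X}(M)$. The difference of connections is $A(X,Y)=\overline{\nabla}_XY-\nabla_XY$. *)

(* Defs.v *)
From HB Require Import structures.
From mathcomp Require Import all_boot all_order all_algebra.
From mathcomp Require Import all_classical all_reals all_analysis.
From mathcomp Require Import ring.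

Set Implicit Arguments.
Unset Strict Implicit.
Unset Printing Implicit Defensive.

Import Order.TTheory GRing.Theory Num.Theory.
Import numFieldNormedType.Exports.

Local Open Scope classical_set_scope.
Local Open Scope ring_scope.

(** [U] is meant to be open: the values of [f] outside of [U] are then
    irrelevant, see [Ck_on_ext]. *)

Section Ck.
Context {R : realType} {V W : normedModType R}.

Fixpoint Ck_on (k : nat) (U : set V) (f : V -> W) : Prop :=
  match k with
  | 0 => forall x, U x -> {for x, continuous f}
  | k.+1 => (forall x, U x -> differentiable f x) /\
            (forall v : V, Ck_on k U ('D_v f))
  end.

Definition smooth_on (U : set V) (f : V -> W) : Prop :=
  forall k, Ck_on k U f.

Lemma near_eq_differentiable (f h : V -> W) (x : V) :
  (\near x, f x = h x) -> differentiable f x -> differentiable h x.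
Proof.
move=> fh fd; have [dfc /eqaddoP dfo] := (diff_locallyP x f).1 fd.
have ho : h \o shift x = cst (h x) + 'd f x +o_ 0 id.
  apply/eqaddoP => e e0; have {}dfo := dfo e e0.
  have fh0 : \forall y \near (0 : V), f (y + x) = h (y + x).
    by move: fh; rewrite (near_shift 0) subr0.
  near=> y.
  have -> : (h \o shift x - (cst (h x) + 'd f x)) y =
            (f \o shift x - (cst (f x) + 'd f x)) y.
    rewrite !fctE /= (nbhs_singleton fh); congr (_ - _).
    by symmetry; near: y.
  by near: y.
by apply/diff_locallyP; rewrite (diff_unique dfc ho).
Unshelve. all: by end_near. Qed.

Lemma Ck_on_ext k (U : set V) (f h : V -> W) :
  open U -> {in U, f =1 h} -> Ck_on k U f -> Ck_on k U h.
Proof.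
move=> oU; elim: k f h => [|k IH] f h fh /=.
  move=> fc x Ux.
  have nfh : \near x, f x = h x.
    by near=> y; apply: fh; rewrite inE; near: y; exact: open_nbhs_nbhs.
  have := fc x Ux; rewrite /prop_for /continuous_at -(nbhs_singleton nfh).
  by apply: cvg_trans; exact: near_eq_cvg.
have nfh x : U x -> \near x, f x = h x.
  move=> Ux.
  by near=> y; apply: fh; rewrite inE; near: y; exact: open_nbhs_nbhs.
move=> [fd fD]; split=> [x Ux|v].
  exact: near_eq_differentiable (nfh x Ux) (fd x Ux).
apply: IH (fD v) => x; rewrite inE => Ux.
by apply: near_eq_derive; exact: nfh.
Unshelve. all: by end_near. Qed.

Lemma Ck_onW k (U : set V) (f : V -> W) : Ck_on k.+1 U f -> Ck_on k U f.
Proof.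
elim: k f => [|k IH] f [fd fD] /=.
  by move=> x Ux; apply: differentiable_continuous; exact: fd.
by split=> // v; exact: IH.
Qed.

Lemma Ck_on_cst k (U : set V) (c : W) : open U -> Ck_on k U (cst c).
Proof.
move=> oU; elim: k c => [|k IH] c /=; first by move=> x _; exact: cst_continuous.
split=> [x _|v]; first exact: differentiable_cst.
by apply: Ck_on_ext (IH 0) => // x _; rewrite derive_cst.
Qed.

Lemma Ck_onD k (U : set V) (f h : V -> W) :
  open U -> Ck_on k U f -> Ck_on k U h -> Ck_on k U (f + h).
Proof.
move=> oU; elim: k f h => [|k IH] f h /=.
  by move=> fc hc x Ux; apply: cvgD; [exact: fc|exact: hc].
move=> [fd fD] [hd hD]; split=> [x Ux|v].
  by apply: differentiableD; [exact: fd|exact: hd].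
apply: Ck_on_ext (IH _ _ (fD v) (hD v)) => // x; rewrite inE => Ux.
by rewrite deriveD//; apply: diff_derivable; [exact: fd|exact: hd].
Qed.

End Ck.

Lemma Ck_onM (R : realType) (V : normedModType R) k (U : set V) (f h : V -> R) :
  open U -> Ck_on k U f -> Ck_on k U h -> Ck_on k U (f * h).
Proof.
move=> oU; elim: k f h => [|k IH] f h.
  by move=> fc hc x Ux; apply: cvgM; [exact: fc|exact: hc].
move=> fk hk; have [fd fD] := fk; have [hd hD] := hk.
split=> [x Ux|v]; first by apply: differentiableM; [exact: fd|exact: hd].
have H := Ck_onD oU (IH _ _ (Ck_onW fk) (hD v)) (IH _ _ (Ck_onW hk) (fD v)).
apply: Ck_on_ext H => // x; rewrite inE => Ux.
by rewrite deriveM//; apply: diff_derivable; [exact: fd|exact: hd].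
Qed.

Section Charts.
Context {R : realType} {n : nat} {M : topologicalType}.

(** Both maps of a chart are total functions, constrained only on the open sets
    [chart_dom] and [chart_fun @` chart_dom] between which they are mutually
    inverse homeomorphisms. *)
Record chart := Chart {
  chart_dom : set M;
  chart_fun : M -> 'rV[R]_n;
  chart_inv : 'rV[R]_n -> M;
  chart_dom_open : open chart_dom;
  chart_codom_open : open (chart_fun @` chart_dom);
  chart_funK : forall p, chart_dom p -> chart_inv (chart_fun p) = p;
  chart_fun_cont : forall p, chart_dom p -> {for p, continuous chart_fun};
  chart_inv_cont : forall x, (chart_fun @` chart_dom) x ->
                     {for x, continuous chart_inv} }.

Definition chart_codom (c : chart) : set 'rV[R]_n := chart_fun c @` chart_dom c.

Definition smooth_transition (c d : chart) : Prop :=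
  smooth_on (chart_fun c @` (chart_dom c `&` chart_dom d))
            (chart_fun d \o chart_inv c).

End Charts.
Arguments chart R n M : clear implicits.

(** The atlas need not be maximal. *)
Record smooth_manifold (R : realType) (n : nat) := SmoothManifold {
  manifold_space :> topologicalType;
  manifold_hausdorff : hausdorff_space manifold_space;
  manifold_second_countable : @second_countable manifold_space;
  atlas : set (chart R n manifold_space);
  atlas_cover : forall p, exists2 c, atlas c & chart_dom c p;
  atlas_smooth : forall c d, atlas c -> atlas d -> smooth_transition c d }.

Section SmoothFunctions.
Context {R : realType} {n : nat} (M : smooth_manifold R n).

Definition smooth (f : M -> R) : Prop :=
  forall c, atlas c -> smooth_on (chart_codom c) (f \o chart_inv c).

Definition smooth_pred : {pred M -> R} := mem [set f | smooth f].

Lemma smooth_cst (a : R) : smooth (cst a).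
Proof. by move=> c _ k; apply: Ck_on_cst; exact: chart_codom_open. Qed.

Lemma smoothD (f h : M -> R) : smooth f -> smooth h -> smooth (f + h).
Proof.
move=> fs hs c ac k.
by apply: Ck_onD (fs c ac k) (hs c ac k); exact: chart_codom_open.
Qed.

Lemma smoothM (f h : M -> R) : smooth f -> smooth h -> smooth (f * h).
Proof.
move=> fs hs c ac k.
by apply: Ck_onM (fs c ac k) (hs c ac k); exact: chart_codom_open.
Qed.

Lemma smoothZ (a : R) (f : M -> R) : smooth f -> smooth (a *: f).
Proof. by move=> fs; have := smoothM (smooth_cst a) fs. Qed.

Lemma smoothN (f : M -> R) : smooth f -> smooth (- f).
Proof. by rewrite -scaleN1r; exact: smoothZ. Qed.

Lemma smooth_subring_closed : subring_closed smooth_pred.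
Proof.
split=> [|f h|f h]; rewrite !inE /=; first exact: smooth_cst.
- by move=> fs hs; apply: smoothD => //; exact: smoothN.
- exact: smoothM.
Qed.

Lemma smooth_scaler_closed : GRing.scaler_closed smooth_pred.
Proof. by move=> a f; rewrite !inE; exact: smoothZ. Qed.

HB.instance Definition _ :=
  GRing.isSubringClosed.Build (M -> R) smooth_pred smooth_subring_closed.
HB.instance Definition _ :=
  GRing.isScaleClosed.Build R (M -> R) smooth_pred smooth_scaler_closed.

Record smooth_fun := SmoothFun {
  smooth_fun_val :> M -> R;
  _ : smooth_fun_val \in smooth_pred }.

HB.instance Definition _ := [isSub for smooth_fun_val].
HB.instance Definition _ := [Choice of smooth_fun by <:].
HB.instance Definition _ := GRing.SubChoice_isSubComPzRing.Build
  (M -> R) smooth_pred smooth_fun smooth_subring_closed.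
HB.instance Definition _ := [SubZmodule_isSubLmodule of smooth_fun by <:].

Definition mk_smooth_fun (f : M -> R) (fs : smooth f) : smooth_fun :=
  SmoothFun (mem_set (fs : [set f | smooth f] f)).

Lemma smooth_funP (f : smooth_fun) : smooth f.
Proof. by case: f => f /= /set_mem. Qed.

End SmoothFunctions.

Section Tangent.
Context {R : realType} {n : nat} (M : smooth_manifold R n).
Local Notation Cinf := (smooth_fun M).

Definition derivation_at (p : M) : {pred Cinf -> R} :=
  mem [set v : Cinf -> R | linear_for *%R v /\
    forall f h : Cinf, v (f * h) = v f * h p + f p * v h].

Lemma derivation_at_submod_closed p : submod_closed (derivation_at p).
Proof.
split=> [|a u v]; rewrite !inE /=.
  split=> [b f h|f h] /=; first by rewrite mulr0 addr0.
  by rewrite mul0r mulr0 addr0.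
move=> [ul uM] [vl vM]; split=> [b f h|f h]; rewrite !fctE /GRing.scale /=.
  by rewrite ul vl !mulrDr addrACA !(mulrCA a b).
by rewrite uM vM !mulrDr !mulrDl addrACA -!mulrA (mulrCA a (f p)).
Qed.

HB.instance Definition _ p := GRing.isSubmodClosed.Build R (Cinf -> R)
  (derivation_at p) (derivation_at_submod_closed p).

Record tangent (p : M) := Tangent {
  tangent_val :> Cinf -> R;
  _ : tangent_val \in derivation_at p }.

HB.instance Definition _ p := [isSub for @tangent_val p].
HB.instance Definition _ p := [Choice of tangent p by <:].
HB.instance Definition _ p := [SubChoice_isSubLmodule of tangent p by <:].

Lemma tangent_linear p (v : tangent p) : linear_for *%R (v : Cinf -> R).
Proof. by case: v => v /= /set_mem[]. Qed.

Lemma tangentM p (v : tangent p) (f h : Cinf) :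
  v (f * h) = v f * h p + f p * v h.
Proof. by case: v => v /= /set_mem[]. Qed.

Definition mk_tangent p (v : Cinf -> R) (vl : linear_for *%R v)
    (vM : forall f h : Cinf, v (f * h) = v f * h p + f p * v h) : tangent p :=
  @Tangent p v (mem_set (conj vl vM)).

(** Smoothness of vector fields is tested on global smooth functions, and that
    of 1-forms and metrics on global vector fields. By means of bump functions
    this agrees with smoothness of the components in every chart. *)
Record vector_field := VectorField {
  vf_at : forall p, tangent p;
  vf_smooth : forall f : Cinf, smooth (fun p => vf_at p f) }.

Definition vf_apply (X : vector_field) (f : Cinf) : Cinf :=
  mk_smooth_fun (vf_smooth X f).

Record one_form := OneForm {
  form_at : forall p, {scalar tangent p};
  form_smooth : forall X : vector_field, smooth (fun p => form_at p (vf_at X p)) }.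

Definition form_apply (w : one_form) (X : vector_field) : Cinf :=
  mk_smooth_fun (form_smooth w X).

Record riemannian_metric := RiemannianMetric {
  metric_at : forall p, tangent p -> tangent p -> R;
  metric_at_linearl : forall p v, linear_for *%R (@metric_at p ^~ v);
  metric_at_sym : forall p u v, @metric_at p u v = metric_at v u;
  metric_at_pos : forall p v, v != 0 -> 0 < @metric_at p v v;
  metric_at_smooth : forall X Y : vector_field,
    smooth (fun p => metric_at (vf_at X p) (vf_at Y p)) }.

Definition metric_apply (g : riemannian_metric) (X Y : vector_field) : Cinf :=
  mk_smooth_fun (metric_at_smooth g X Y).

End Tangent.

Coercion vf_apply : vector_field >-> Funclass.
Coercion form_apply : one_form >-> Funclass.
Coercion metric_apply : riemannian_metric >-> Funclass.

Section VectorFieldModule.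
Context {R : realType} {n : nat} (M : smooth_manifold R n).
Local Notation Cinf := (smooth_fun M).
Local Notation VF := (vector_field M).
Implicit Types (X Y Z : VF) (f h : Cinf).

Lemma smooth_fun_eq f h : (forall p, f p = h p) -> f = h.
Proof. by move=> fh; apply: val_inj; apply/funext => p; exact: fh. Qed.

Lemma smooth_fun_addE f h p : (f + h) p = f p + h p.
Proof. by []. Qed.

Lemma smooth_fun_mulE f h p : (f * h) p = f p * h p.
Proof. by []. Qed.

Lemma vf_eq X Y : (forall p, vf_at X p = vf_at Y p) -> X = Y.
Proof.
case: X Y => [X Xs] [Y Ys] /= XY.
have XY' : X = Y by apply: functional_extensionality_dep.
by rewrite XY' in Xs Ys *; congr VectorField; exact: Prop_irrelevance.
Qed.

HB.instance Definition _ := gen_eqMixin VF.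
HB.instance Definition _ := gen_choiceMixin VF.

Definition vf_zero : VF := @VectorField _ _ M (fun=> 0) (fun=> smooth_cst 0).

Definition vf_add X Y : VF := @VectorField _ _ M
  (fun p => vf_at X p + vf_at Y p)
  (fun f => smoothD (vf_smooth X f) (vf_smooth Y f)).

Definition vf_opp X : VF := @VectorField _ _ M
  (fun p => - vf_at X p) (fun f => smoothN (vf_smooth X f)).

Definition vf_scale f X : VF := @VectorField _ _ M
  (fun p => f p *: vf_at X p)
  (fun h => smoothM (smooth_funP f) (vf_smooth X h)).

Fact vf_addA : associative vf_add.
Proof. by move=> X Y Z; apply: vf_eq => p /=; rewrite addrA. Qed.
Fact vf_addC : commutative vf_add.
Proof. by move=> X Y; apply: vf_eq => p /=; rewrite addrC. Qed.
Fact vf_add0 : left_id vf_zero vf_add.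
Proof. by move=> X; apply: vf_eq => p /=; rewrite add0r. Qed.
Fact vf_addN : left_inverse vf_zero vf_opp vf_add.
Proof. by move=> X; apply: vf_eq => p /=; rewrite addNr. Qed.

HB.instance Definition _ :=
  GRing.isZmodule.Build VF vf_addA vf_addC vf_add0 vf_addN.

Fact vf_scaleA f h X : vf_scale f (vf_scale h X) = vf_scale (f * h) X.
Proof. by apply: vf_eq => p /=; rewrite scalerA. Qed.
Fact vf_scale1 : left_id 1 vf_scale.
Proof. by move=> X; apply: vf_eq => p /=; rewrite scale1r. Qed.
Fact vf_scaleDr : right_distributive vf_scale +%R.
Proof. by move=> f X Y; apply: vf_eq => p /=; rewrite scalerDr. Qed.
Fact vf_scaleDl X : {morph vf_scale^~ X : f h / f + h >-> f + h}.
Proof. by move=> f h; apply: vf_eq => p /=; rewrite scalerDl. Qed.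

HB.instance Definition _ := GRing.Zmodule_isLmodule.Build Cinf VF
  vf_scaleA vf_scale1 vf_scaleDr vf_scaleDl.

Section LieBracket.
Variables X Y : VF.

Definition bracket_at (p : M) (f : Cinf) : R := X (Y f) p - Y (X f) p.

Lemma vf_apply_linear Z : linear_for *:%R (Z : Cinf -> Cinf).
Proof.
by move=> a f h; apply: smooth_fun_eq => p; exact: (tangent_linear (vf_at Z p)).
Qed.

Lemma vf_applyM Z f h : Z (f * h) = Z f * h + f * Z h.
Proof. by apply: smooth_fun_eq => p; exact: (tangentM (vf_at Z p)). Qed.

Lemma bracket_linear p : linear_for *%R (bracket_at p).
Proof.
move=> a f h; rewrite /bracket_at !vf_apply_linear.
by rewrite mulrBr opprD addrACA.
Qed.

Lemma bracketM p f h :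
  bracket_at p (f * h) = bracket_at p f * h p + f p * bracket_at p h.
Proof.
have vD Z (u v : Cinf) : Z (u + v) = Z u + Z v.
  by have := vf_apply_linear Z 1 u v; rewrite !scale1r.
rewrite /bracket_at !vf_applyM !vD !vf_applyM.
by rewrite !(smooth_fun_addE, smooth_fun_mulE); ring.
Qed.

Lemma bracket_smooth f : smooth (fun p => bracket_at p f).
Proof. by apply: smoothD; [|apply: smoothN]; exact: smooth_funP. Qed.

Definition lie_bracket : VF := @VectorField _ _ M
  (fun p => mk_tangent (bracket_linear p) (bracketM p)) bracket_smooth.

End LieBracket.
End VectorFieldModule.

Section Structures.
Context {R : realType} {n : nat} {M : smooth_manifold R n}.
Local Notation VF := (vector_field M).

Definition is_connection (nabla : VF -> VF -> VF) : Prop :=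
  [/\ forall Y : VF, linear (nabla^~ Y),
      forall X Y Z : VF, nabla X (Y + Z) = nabla X Y + nabla X Z &
      forall (X : VF) (f : smooth_fun M) (Y : VF),
        nabla X (f *: Y) = X f *: Y + f *: nabla X Y].

Definition is_levi_civita (g : riemannian_metric M)
    (nabla : VF -> VF -> VF) : Prop :=
  [/\ is_connection nabla,
      forall X Y : VF, nabla X Y - nabla Y X = lie_bracket X Y &
      forall X Y Z : VF, X (g Y Z) = g (nabla X Y) Z + g Y (nabla X Z)].

Definition connection_difference (nablabar nabla : VF -> VF -> VF) :
    VF -> VF -> VF :=
  fun X Y => nablabar X Y - nabla X Y.

Definition is_tensor12 (A : VF -> VF -> VF) : Prop :=
  (forall X : VF, linear (A X)) /\ (forall Y : VF, linear (A^~ Y)).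

Definition formal_frobenius (g : riemannian_metric M)
    (A : VF -> VF -> VF) : Prop :=
  [/\ is_tensor12 A,
      forall X Y Z : VF, g (A X Y) Z = g X (A Y Z) &
      forall X Y : VF, A X Y = A Y X].

End Structures.

(* Main.v *)
Require Import Defs.
From mathcomp Require Import all_boot all_order all_algebra.
From mathcomp Require Import all_classical all_reals all_analysis.
Import GRing.Theory.

Local Open Scope ring_scope.

Section SmoothLinearity.
Context {R : realType} {n : nat} {M : smooth_manifold R n}.
Implicit Types (f : smooth_fun M) (X Y Z : vector_field M).

(** The subgeodesic formula makes A bilinear over smooth functions and symmetric at sight, so being
    formal Frobenius reduces to g(A(X,Y),Z) = g(X,A(Y,Z)). Expanding both sides by
    [metric_subgeodesic_tensor], the term theta(Y)g(X,Z) occurs on each; cancelling it leaves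
    exactly the stated identity, with psi(Z) = g(P,Z). *)

Lemma form_apply_linear (w : one_form M) : linear_for *%R (form_apply w).
Proof.
by move=> f X Y; apply: smooth_fun_eq => p; exact: linearP (form_at w p) _ _ _.
Qed.

Lemma metric_applyC (g : riemannian_metric M) X Y : g X Y = g Y X.
Proof. by apply: smooth_fun_eq => p; exact: metric_at_sym. Qed.

Lemma metric_apply_linearl (g : riemannian_metric M) Z :
  linear_for *%R (metric_apply g ^~ Z).
Proof.
by move=> f X Y; apply: smooth_fun_eq => p; exact: metric_at_linearl.
Qed.

Lemma metric_apply_linearr (g : riemannian_metric M) Z :
  linear_for *%R (metric_apply g Z).
Proof.
by move=> f X Y; rewrite !(metric_applyC g Z) metric_apply_linearl.
Qed.

(** Naming the right-hand side of the subgeodesic relation separates the algebra over [smooth_fun M]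
    from the connections. *)
Definition subgeodesic_tensor (g : riemannian_metric M) (theta : one_form M)
    (P X Y : vector_field M) : vector_field M :=
  theta X *: Y + theta Y *: X + g X Y *: P.

Lemma subgeodesic_tensorC g theta P X Y :
  subgeodesic_tensor g theta P X Y = subgeodesic_tensor g theta P Y X.
Proof.
by rewrite /subgeodesic_tensor metric_applyC (addrC (theta X *: Y)).
Qed.

Lemma subgeodesic_tensor12 g theta P :
  is_tensor12 (subgeodesic_tensor g theta P).
Proof.
have linr X : linear (subgeodesic_tensor g theta P X).
  move=> f Y Z; rewrite /subgeodesic_tensor form_apply_linear.
  rewrite metric_apply_linearr !scalerDl !scalerDr !scalerA (mulrC (theta X)).
  by rewrite (addrACA (_ *: Y)) (addrACA (_ *: Y + _)).
(* Symmetry carries linearity from the second slot to the first. *)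
by split=> // Y f X Z; rewrite !(subgeodesic_tensorC _ _ _ _ Y); exact: linr.
Qed.

Lemma metric_subgeodesic_tensor (g : riemannian_metric M) theta P X Y Z :
  g (subgeodesic_tensor g theta P X Y) Z =
  theta X * g Y Z + theta Y * g X Z + g X Y * g P Z.
Proof.
rewrite /subgeodesic_tensor -addrA !metric_apply_linearl addrA; congr (_ + _).
(* [linear_for] speaks of sums f *: X + Y, so the last summand g X Y *: P is padded with a zero
   field, whose pairing with Z must vanish. *)
have g0 : g 0 Z = 0.
  by apply: (addrI (g 0 Z)); rewrite -{1}(mul1r (g 0 Z)) -metric_apply_linearl
    scaler0 !addr0.
by rewrite -[W in g W Z]addr0 metric_apply_linearl g0 addr0.
Qed.

End SmoothLinearity.

Theorem proposition2p1 (R : realType) (n : nat) (M : smooth_manifold R n)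
  (g gbar : riemannian_metric M)
  (nabla nablabar : vector_field M -> vector_field M -> vector_field M)
  (nablaP : is_levi_civita g nabla)
  (nablabarP : is_levi_civita gbar nablabar)
  (theta : one_form M) (P : vector_field M)
  (subgeodesic : forall X Y : vector_field M,
     connection_difference nablabar nabla X Y =
     theta X *: Y + theta Y *: X + g X Y *: P)
  (psi : one_form M)
  (psiP : forall X : vector_field M, psi X = g P X) :
  formal_frobenius g (connection_difference nablabar nabla) <->
  (forall X Y Z : vector_field M,
     theta X * g Y Z + psi Z * g Y X = theta Z * g Y X + psi X * g Y Z).
Proof.
have AE : connection_difference nablabar nabla = subgeodesic_tensor g theta P.
  by apply/funext => X; apply/funext => Y; exact: subgeodesic.
have compatE X Y Z :
    (g (subgeodesic_tensor g theta P X Y) Z =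
       g X (subgeodesic_tensor g theta P Y Z)) <->
    (theta X * g Y Z + psi Z * g Y X = theta Z * g Y X + psi X * g Y Z).
  (* Symmetry of the metric moves the tensor into the first slot on the right, so that one expansion
     serves both sides. *)
  rewrite (metric_applyC g X) !metric_subgeodesic_tensor !psiP.
  rewrite (metric_applyC g Z X) (metric_applyC g X Y).
  (* The common term theta Y * g X Z is brought to the front of both sides, ready to be
     cancelled. *)
  rewrite (addrC (theta X * _)) (mulrC (g Y X)) (mulrC (g Y Z)) -!addrA.
  by split=> [/addrI|->].
rewrite AE; split=> [[_ compat _] X Y Z|H]; first exact/compatE.
split; first exact: subgeodesic_tensor12.
- by move=> X Y Z; exact/compatE.
- exact: subgeodesic_tensorC.
Qed.
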